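(* Let $n\ge5$ and let $D$ be an $n\times n$ Euclidean distance matrix with embedding dimension $3$, with generating points $p^1,\ldots,p^n\in\mathbb{R}^3$ affinely spanning $\mathbb{R}^3$ and satisfying $\sum_{i=1}^n p^i=\mathbf{0}$. Let $P$ be the $n\times 3$ matrix whose $i$-th row is $(p^i)^T$, let $B=PP^T$, $b=\mathrm{diag}(B)$, and let $B^{\dagger}$ be the Moore-Penrose inverse of $B$. Let $P^TP=S'\Lambda'{S'}^T$ be a spectral decomposition, with $S'$ orthogonal and $\Lambda'$ the diagonal matrix of the eigenvalues $\nu_1\ge\nu_2\ge\nu_3>0$. Let $d^m\in\mathbb{R}^n$, $\kappa_n(d^m)=\frac4n e^T(d^m-b)-(d^m-b)^TB^{\dagger}(d^m-b)$, and $w={S'}^TP^T(d^m-b)\in\mathbb{R}^3$. Assume $w_3\neq0$, and define $$f(\lambda)=\sum_{i=1}^3\frac{w_i^2}{(\nu_i-\lambda)^2}+\frac8n\lambda-\frac4ne^T(d^m-b),\qquad\lambda<\nu_3.$$ Consider the problem $$(\mathcal{P})\qquad \min_{y\in\mathbb{R}^n}\ \|y-d^m\|^2\quad\text{subject to}\quad\begin{bmatrix}0&y^T\\ y&D\end{bmatrix}\text{ is an EDM of embedding dimension }3.$$ Then $f$ is strictly increasing for $\lambda<\nu_3$, and $f(0)=-\kappa_n(d^m)$. Moreover: (i) if $\kappa_n(d^m)=0$, then $\lambda=0$ is the root of $f(\lambda)$ and the optimal solution of $(\mathcal{P})$ is $y^*=d^m$, indicating that $d^m$ is self-consistent; (ii)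 if $\kappa_n(d^m)>0$, then $f(\lambda)$ has a unique root in the interval $(0,\nu_3)$; (iii) if $\kappa_n(d^m)<0$, then $f(\frac n8\kappa_n(d^m))<0$ and $f(\lambda)$ has a unique root in the interval $(\frac n8\kappa_n(d^m),0)$. With $\lambda^*$ denoting the root of $f(\lambda)=0$, the optimal solution of $(\mathcal{P})$ is $$y^*=Px^*+s^*e+b,$$ where $$x^*=(P^TP-\lambda^*I)^{-1}P^T(d^m-b),\qquad s^*=\frac1n\bigl(e^T(d^m-b)-2\lambda^*\bigr).$$
   Context: An $n\times n$ matrix $D=(d_{ij})$ is a Euclidean distance matrix (EDM) if there are points $p^1,\ldots,p^n$ (generating points of $D$) in some Euclidean space with $d_{ij}=\|p^i-p^j\|^2$ for all $i,j$; the dimension of their affine span is the embedding dimension of $D$. Given the EDM $D$ of embedding dimension $3$, a vector $y\in\mathbb{R}^n$ is called self-consistent if the $(n+1)\times(n+1)$ matrix $\begin{bmatrix}0&y^T\\ y&D\end{bmatrix}$ is an EDM with embedding dimension $3$. Here $e$ is the all-ones vector in $\mathbb{R}^n$, $I$ the identity matrix, $\mathrm{diag}(B)$ the vector of diagonal entries of $B$, $w_i$ the $i$-th entry of $w$, and $\|\cdot\|$ the Euclidean norm.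
   Formalization: In (i), the claim that y*=d^m is optimal and d^m is self-consistent is proved under the added (necessary) hypothesis that d^m-b=Px+se for some x in R^3 and real s; without it the claim fails (e.g. octahedron, d^m=(3,3,1,1,4,0)). *)

(* Defs.v *)
From HB Require Import structures.
From mathcomp Require Import all_boot all_order all_algebra.
From mathcomp Require Import reals.

Set Implicit Arguments.
Unset Strict Implicit.
Unset Printing Implicit Defensive.

Import Order.TTheory GRing.Theory Num.Theory.
Local Open Scope ring_scope.

(* Used for row and column vectors.  The norm that MathComp-Analysis puts on
   matrices is the sup norm, hence this definition. *)
Definition enorm (R : realType) m k (u : 'M[R]_(m, k)) : R :=
  Num.sqrt (\sum_i \sum_j u i j ^+ 2).

(* Points are the rows of a matrix. *)
Definition generating_points (R : realType) n k
    (Q : 'M[R]_(n, k)) (D : 'M[R]_n) : Prop :=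
  forall i j, D i j = enorm (row i Q - row j Q) ^+ 2.

(* The direction space of the affine span of the rows of Q is spanned by all
   the differences of two rows. *)
Definition affine_dim (R : realType) n k (Q : 'M[R]_(n, k)) : nat :=
  \rank (\sum_(i < n) \sum_(j < n) <<row i Q - row j Q>>)%MS.

Definition EDM_of_dim (R : realType) n (D : 'M[R]_n) (r : nat) : Prop :=
  exists k (Q : 'M[R]_(n, k)), generating_points Q D /\ affine_dim Q = r.

Definition self_consistent (R : realType) n (D : 'M[R]_n) (y : 'cV[R]_n)
    : Prop :=
  EDM_of_dim (block_mx (0 : 'M_1) y^T y D) 3.

Definition optimal (R : realType) n (D : 'M[R]_n) (dm y : 'cV[R]_n) : Prop :=
  self_consistent D y /\
  forall z, self_consistent D z -> enorm (y - dm) ^+ 2 <= enorm (z - dm) ^+ 2.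

(* The four Penrose equations; they determine X.  MathComp's pinvmx satisfies
   only the first of them in general. *)
Definition moore_penrose (R : realType) m n (A : 'M[R]_(m, n))
    (X : 'M[R]_(n, m)) : Prop :=
  [/\ A *m X *m A = A, X *m A *m X = X,
      (A *m X)^T = A *m X & (X *m A)^T = X *m A].

(* Main.v *)
(** Realising the bordered matrix amounts to adding one point p of R^3, so with
    x = -2p and s = |p|^2 the feasible vectors are y = Px + se + b with
    |x|^2 = 4s. Since P^T e = 0, for every l < nu_3 the Lagrangian
    |Px + se - c|^2 - l (|x|^2 - 4s), where c = d^m - b, is a strictly convex
    quadratic, minimised at a single point, which satisfies the constraint
    exactly when f(l) = 0, and is then the unique solution of (P). Existence
    and uniqueness of the root follow from monotonicity of f and its pole
    at nu_3. *)

Require Import Defs.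
From mathcomp Require Import all_boot all_order all_algebra.
From mathcomp Require Import reals.
From mathcomp Require Import ring lra.

Set Implicit Arguments.
Unset Strict Implicit.
Unset Printing Implicit Defensive.

Import Order.TTheory GRing.Theory Num.Theory.
Local Open Scope ring_scope.

(** * The secular function to the left of its poles *)

Section SecularFunction.
Variables (R : rcfType) (k : nat) (a nu : 'I_k -> R) (al be m : R).
Hypotheses (al_gt0 : 0 < al) (m_le : forall i, m <= nu i).

(** This is [f] with its data abstracted; [m] bounds the poles [nu i] from below, as [nu3] does. *)
Definition secular (l : R) : R :=
  \sum_i a i ^+ 2 / (nu i - l) ^+ 2 + al * l - be.

Lemma secular_sum_le l1 l2 i : l1 <= l2 -> l2 < m ->
  a i ^+ 2 / (nu i - l1) ^+ 2 <= a i ^+ 2 / (nu i - l2) ^+ 2.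
Proof.
move=> l12 l2m; have := m_le i => mi.
rewrite ler_wpM2l ?sqr_ge0// lef_pV2 ?posrE ?exprn_gt0 ?lerXn2r ?nnegrE//; lra.
Qed.

(** The sum is only nondecreasing, as all [a i] may vanish; strictness comes from [al * l]. *)
Lemma secular_lt l1 l2 : l1 < l2 -> l2 < m -> secular l1 < secular l2.
Proof.
move=> l12 l2m; rewrite /secular ltrD2r ler_ltD ?ltr_pM2l//.
by apply: ler_sum => i _; rewrite secular_sum_le// ltW.
Qed.

Lemma secular_root_inj l1 l2 : l1 < m -> l2 < m ->
  secular l1 = 0 -> secular l2 = 0 -> l1 = l2.
Proof.
move=> l1m l2m f1 f2; case: (ltgtP l1 l2) => // l12.
- by have := secular_lt l12 l2m; rewrite f1 f2 ltxx.
- by have := secular_lt l12 l1m; rewrite f1 f2 ltxx.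
Qed.

(* Clearing denominators gives a polynomial of the same sign to the left of
   the poles, so that the intermediate value theorem for polynomials applies. *)
Lemma secular_ivt l1 l2 : l1 <= l2 -> l2 < m ->
  secular l1 < 0 -> 0 < secular l2 -> exists l, l1 < l < l2 /\ secular l = 0.
Proof.
move=> l12 l2m f1 f2.
pose q := \prod_i ((nu i)%:P - 'X) ^+ 2.
pose p := \sum_i (a i ^+ 2)%:P * \prod_(j | j != i) ((nu j)%:P - 'X) ^+ 2
          + (al *: 'X - be%:P) * q.
have q_gt0 l : l < m -> 0 < q.[l].
  move=> lm; rewrite horner_prod prodr_gt0// => i _.
  by rewrite !hornerE exprn_gt0//; have := m_le i; lra.
have pE l : l < m -> p.[l] = secular l * q.[l].
  move=> lm; rewrite /p /secular hornerD hornerM horner_sum -addrA mulrDl.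
  congr (_ + _); last by rewrite !hornerE.
  rewrite mulr_suml; apply: eq_bigr => i _.
  have nul : nu i - l != 0 by have := m_le i; lra.
  rewrite /q [in RHS](bigD1 i)//= 2!hornerM hornerC horner_exp hornerD.
  by rewrite hornerN hornerC hornerX mulrA divfK// sqrf_eq0.
have [|l] := @poly_ivt R p l1 l2 l12.
  by rewrite !pE ?(le_lt_trans l12)// ?ltW// ?nmulr_rlt0 ?mulr_gt0 ?q_gt0//
    ?(le_lt_trans l12).
case/andP=> l1l ll2 /rootP.
rewrite pE ?(le_lt_trans ll2)// => /eqP.
rewrite mulf_eq0 (gt_eqF (q_gt0 _ (le_lt_trans ll2 l2m))) orbF => /eqP f0.
(* The root lies in the closed interval; the strict signs at [l1] and [l2] exclude the endpoints. *)
exists l; split=> //; rewrite !lt_neqAle l1l ll2 !andbT.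
by apply/andP; split; apply/eqP => e; subst; lra.
Qed.

(** The term of index [i] blows up at the pole [m], because [a i] is nonzero, and outweighs the
    affine part. *)
Lemma secular_gt0 l0 i : nu i = m -> a i != 0 -> l0 < m ->
  exists l, l0 < l < m /\ 0 < secular l.
Proof.
move=> nui ai l0m; pose M := `|al * l0 - be| + 1.
have M_gt0 : 0 < M by rewrite ltr_wpDl.
have a2_gt0 : 0 < a i ^+ 2 by rewrite exprn_even_gt0.
(* [d <= 1] gives [d ^+ 2 <= d], the second bound keeps [m - d] to the right of [l0], and the third
   gives [M <= a i ^+ 2 / d]. *)
pose d := Num.min 1 (Num.min ((m - l0) / 2) (a i ^+ 2 / M)).
have d_gt0 : 0 < d by rewrite !lt_min ltr01 !divr_gt0// subr_gt0.
have : d <= 1 /\ d <= (m - l0) / 2 /\ d <= a i ^+ 2 / M.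
  by split; [|split]; rewrite !ge_min lexx ?orbT.
case=> d1 [d2 d3]; exists (m - d); split; first by apply/andP; split; lra.
have ge_M : M <= a i ^+ 2 / d ^+ 2.
  rewrite ler_pdivlMr ?exprn_gt0//.
  rewrite ler_pdivlMr// in d3; apply: le_trans d3.
  by rewrite mulrC ler_pM2r// expr2 ler_piMl// ltW.
have : M <= \sum_j a j ^+ 2 / (nu j - (m - d)) ^+ 2.
  rewrite (bigD1 i)//= nui subKr ler_wpDr// sumr_ge0// => j _.
  by rewrite divr_ge0 ?sqr_ge0.
have : al * l0 <= al * (m - d) by rewrite ler_pM2l//; lra.
have := ler_norm (- (al * l0 - be)); rewrite normrN /secular /M.
lra.
Qed.

End SecularFunction.

(** * Squared norms and the rank of a Gram matrix *)

Section EuclideanNorm.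
Variable R : realType.

Lemma enorm_sqr m n (u : 'M[R]_(m, n)) :
  enorm u ^+ 2 = \sum_i \sum_j u i j ^+ 2.
Proof.
by rewrite sqr_sqrtr// sumr_ge0// => i _; rewrite sumr_ge0// => j _; apply: sqr_ge0.
Qed.

Lemma enorm_sqr_row n (u : 'rV[R]_n) : enorm u ^+ 2 = (u *m u^T) 0 0.
Proof.
by rewrite enorm_sqr big_ord1 mxE; apply: eq_bigr => i _; rewrite mxE expr2.
Qed.

Lemma enorm_sqr_col n (u : 'cV[R]_n) : enorm u ^+ 2 = (u^T *m u) 0 0.
Proof.
rewrite enorm_sqr mxE; apply: eq_bigr => i _.
by rewrite big_ord1 mxE expr2.
Qed.

Lemma enorm_sqr_eq0 m n (u : 'M[R]_(m, n)) : enorm u ^+ 2 = 0 -> u = 0.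
Proof.
rewrite enorm_sqr => /eqP; rewrite psumr_eq0; last first.
  by move=> i _; rewrite sumr_ge0// => j _; apply: sqr_ge0.
move=> /allP u0; apply/matrixP => i j; rewrite mxE; apply/eqP.
have := u0 i (mem_index_enum _).
rewrite /= psumr_eq0; last by move=> ? _; apply: sqr_ge0.
by move=> /allP /(_ j (mem_index_enum _)); rewrite /= sqrf_eq0.
Qed.

(** A row u = v M killed by [M^T] has |u|^2 = u M^T v^T = 0, so multiplying by [M^T] loses no
    rank. *)
Lemma mxrank_gram m n (M : 'M[R]_(m, n)) : \rank (M *m M^T) = \rank M.
Proof.
rewrite -[RHS](mxrank_mul_ker M M^T).
suff -> : (M :&: kermx M^T)%MS = 0 by rewrite mxrank0 addn0.
apply/eqP; rewrite -submx0; apply/rV_subP => u; rewrite sub_capmx.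
case/andP => /submxP[v uv] /sub_kermxP u0.
by rewrite submx0; apply/eqP/enorm_sqr_eq0;
  rewrite enorm_sqr_row {2}uv trmx_mul mulmxA u0 mul0mx mxE.
Qed.

End EuclideanNorm.

(** * Realisations of a distance matrix *)

Section GeneratingPoints.
Variable R : realType.

(** Placing the origin at point [o] turns affine dimension into rank and squared distances into
    inner products. *)
Definition diffs n k (o : 'I_n) (Q : 'M[R]_(n, k)) : 'M[R]_(n, k) :=
  \matrix_i (row i Q - row o Q).

Lemma affine_dim_diffs n k (o : 'I_n) (Q : 'M[R]_(n, k)) :
  affine_dim Q = \rank (diffs o Q).
Proof.
apply/eqP; rewrite eqn_leq !mxrankS//.
- apply/row_subP => i; rewrite rowK.
  by rewrite (sumsmx_sup i)// (sumsmx_sup o)// genmxE.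
- apply/sumsmx_subP => i _; apply/sumsmx_subP => j _; rewrite genmxE.
  have -> : row i Q - row j Q = row i (diffs o Q) - row j (diffs o Q).
    by rewrite !rowK opprB addrA subrK.
  by rewrite addmx_sub ?eqmx_opp ?row_sub.
Qed.

(** Polarisation: [D] alone determines the Gram matrix of the translated points. *)
Lemma gram_diffs n k (o : 'I_n) (Q : 'M[R]_(n, k)) D i j :
  generating_points Q D ->
  (diffs o Q *m (diffs o Q)^T) i j = (D i o + D j o - D i j) / 2.
Proof.
move=> genD; rewrite !genD !enorm_sqr !big_ord1 -big_split -sumrB mulr_suml mxE.
by apply: eq_bigr => l _; rewrite !mxE/=; field.
Qed.

Lemma eq_gram_diffs n k k' (o : 'I_n) (P : 'M[R]_(n, k)) (Q : 'M[R]_(n, k')) D :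
  generating_points P D -> generating_points Q D ->
  diffs o P *m (diffs o P)^T = diffs o Q *m (diffs o Q)^T.
Proof.
move=> genP genQ; apply/matrixP => i j.
by rewrite (gram_diffs _ _ _ genP) (gram_diffs _ _ _ genQ).
Qed.

(** The affine dimension is the rank of a Gram matrix that [D] determines. *)
Lemma eq_affine_dim n k k' (o : 'I_n) (P : 'M[R]_(n, k)) (Q : 'M[R]_(n, k')) D :
  generating_points P D -> generating_points Q D ->
  affine_dim P = affine_dim Q.
Proof.
move=> genP genQ; rewrite !(affine_dim_diffs o) -mxrank_gram.
by rewrite (eq_gram_diffs o genP genQ) mxrank_gram.
Qed.

Lemma diffs_col_mx n k (o : 'I_n) (q : 'rV[R]_k) (Q : 'M[R]_(n, k)) :
  diffs (rshift 1 o) (col_mx q Q) = col_mx (q - row o Q) (diffs o Q).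
Proof.
apply/matrixP => i j; rewrite !mxE (unsplitK (inr o)).
by case: (split i) => l; rewrite !mxE ?ord1.
Qed.

Lemma generating_col_mx n k (q : 'rV[R]_k) (Q : 'M[R]_(n, k)) D (y : 'cV_n) :
  generating_points (col_mx q Q) (block_mx (0 : 'M_1) y^T y D) <->
  generating_points Q D /\ forall i, y i 0 = enorm (q - row i Q) ^+ 2.
Proof.
have rowl : row (lshift n 0) (col_mx q Q) = q by rewrite rowKu row_id.
have rowr i : row (rshift 1 i) (col_mx q Q) = row i Q by rewrite rowKd.
split=> [gen | [genQ yE] i j].
  split=> [i j | i]; first by have := gen (rshift 1 i) (rshift 1 j); rewrite block_mxEdr !rowr.
  by have := gen (lshift n 0) (rshift 1 i); rewrite block_mxEur mxE rowl rowr.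
case: (split_ordP i) => {}i ->; case: (split_ordP j) => {}j ->; rewrite ?ord1.
- rewrite block_mxEul rowl subrr mxE enorm_sqr big_ord1 big1// => l _.
  by rewrite mxE expr0n.
- by rewrite block_mxEur mxE rowl rowr yE.
- rewrite block_mxEdl rowl rowr yE !enorm_sqr !big_ord1; apply: eq_bigr => l _.
  by rewrite -sqrrN !mxE opprB.
- by rewrite block_mxEdr !rowr genQ.
Qed.

(* Any realisation of the bordered matrix puts the new point in the affine span
   of the old ones; its affine coordinates transport it to the span of P,
   since all the distances involved are determined by D. *)
Lemma self_consistentP n (o : 'I_n) (P : 'M[R]_(n, 3)) D (y : 'cV_n) :
  generating_points P D -> affine_dim P = 3%N ->
  self_consistent D y <->
  exists p : 'rV_3, forall i, y i 0 = enorm (p - row i P) ^+ 2.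
Proof.
move=> genP dimP; split=> [[k [Q [genQ dimQ]]] | [p yE]]; last first.
  exists 3%N, (col_mx p P); split; first exact/generating_col_mx.
  (* The rank is at most 3 by the number of columns, and at least 3 because the rows from [P]
     remain. *)
  apply/eqP; rewrite (affine_dim_diffs (rshift 1 o)) eqn_leq rank_leq_col.
  rewrite -[X in (X <= _)%N]dimP (affine_dim_diffs o) mxrankS// diffs_col_mx.
  by rewrite -addsmxE addsmxSr.
rewrite -[Q]vsubmxK in genQ dimQ.
move: (usubmx Q) (dsubmx Q) genQ dimQ => q {}Q /generating_col_mx[genQ yE].
rewrite (affine_dim_diffs (rshift 1 o)) diffs_col_mx => dimQ.
(* [diffs o Q] has rank 3, since [P] realises the same [D]; adding the row of [q] keeps rank 3, so
   that row lies in its row space. *)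
have /submxP[v vE] : (q - row o Q <= diffs o Q)%MS.
  have sub : (diffs o Q <= col_mx (q - row o Q) (diffs o Q))%MS.
    by rewrite -addsmxE addsmxSr.
  have := mxrank_leqif_sup sub.
  rewrite -(affine_dim_diffs o) -(eq_affine_dim o genP genQ) dimP dimQ => -[_].
  by rewrite eqxx col_mx_sub => /esym/andP[].
(* The distances are quadratic forms in the Gram matrix, hence the same for [Q] and [P] once [v] is
   fixed. *)
have distE m (M : 'M[R]_(n, m)) i : enorm (v *m diffs o M + row o M - row i M) ^+ 2
    = ((v - delta_mx 0 i) *m (diffs o M *m (diffs o M)^T) *m (v - delta_mx 0 i)^T) 0 0.
  have -> : v *m diffs o M + row o M - row i M = (v - delta_mx 0 i) *m diffs o M.
    by rewrite mulmxBl -rowE rowK opprB addrA.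
  by rewrite enorm_sqr_row trmx_mul !mulmxA.
exists (v *m diffs o P + row o P) => i.
by rewrite yE distE (eq_gram_diffs o genP genQ) -distE -vE subrK.
Qed.

Lemma self_consistent_param n (o : 'I_n) (P : 'M[R]_(n, 3)) D (y : 'cV_n) :
  generating_points P D -> affine_dim P = 3%N ->
  self_consistent D y <->
  exists (x : 'cV_3) s, (x^T *m x) 0 0 = 4 * s /\
    y = P *m x + s *: const_mx 1 + \col_i (P *m P^T) i i.
Proof.
move=> genP dimP; rewrite (self_consistentP o _ genP dimP).
(* This is |p - p^i|^2 expanded at p = -x/2, with [s] already replaced by |x|^2/4. *)
have entryE (x : 'cV_3) i : (P *m x + ((x^T *m x) 0 0 / 4) *: const_mx 1
      + \col_i (P *m P^T) i i) i 0 = enorm (- 2^-1 *: x^T - row i P) ^+ 2.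
  rewrite enorm_sqr big_ord1 !mxE mulr1 mulr_suml -!big_split/=.
  by apply: eq_bigr => j _; rewrite !mxE; field.
split=> [[p yE] | [x [s [xs ->]]]].
  exists (- 2 *: p^T), (((- 2 *: p^T)^T *m (- 2 *: p^T)) 0 0 / 4).
  split; first by field.
  apply/colP => i; rewrite entryE yE linearZ/= trmxK scalerA.
  by rewrite mulrNN mulVf ?pnatr_eq0// scale1r.
exists (- 2^-1 *: x^T) => i; rewrite -entryE xs.
by rewrite [4 * s]mulrC mulfK ?pnatr_eq0.
Qed.

End GeneratingPoints.

(** * Moore-Penrose inverses *)

Section MoorePenrose.
Variable R : realType.

(** [A *m X] and [A *m Y] are the same orthogonal projector, and so are [X *m A] and [Y *m A]. *)
Lemma moore_penrose_uniq m n (A : 'M[R]_(m, n)) (X Y : 'M[R]_(n, m)) :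
  moore_penrose A X -> moore_penrose A Y -> X = Y.
Proof.
move=> [AXA XAX AXt XAt] [AYA YAY AYt YAt].
have AXY : A *m X = A *m Y.
  by rewrite -AXt -{1}AYA -mulmxA trmx_mul AXt AYt mulmxA AXA.
have XAY : X *m A = Y *m A.
  by rewrite -XAt -{1}AYA !mulmxA -mulmxA trmx_mul XAt YAt -mulmxA [A *m _]mulmxA AXA.
by rewrite -XAX -mulmxA AXY mulmxA XAY YAY.
Qed.

(** With N for [diag_mx nu], both products with the candidate reduce to V N^-1 V^T, which is
    symmetric and fixes [V]. *)
Lemma moore_penrose_gram n k (V : 'M[R]_(n, k)) (nu : 'rV[R]_k) :
  V^T *m V = diag_mx nu -> (forall i, nu 0 i != 0) ->
  moore_penrose (V *m V^T) (V *m diag_mx (\row_i (nu 0 i) ^- 2) *m V^T).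
Proof.
move=> VV nu0; set N2 := diag_mx _.
pose N1 : 'M[R]_k := diag_mx (\row_i (nu 0 i)^-1).
have N1E : diag_mx nu *m N2 = N1.
  rewrite mulmx_diag; congr diag_mx; apply/rowP => i; rewrite !mxE.
  by rewrite expr2 invfM mulrA divff ?mul1r.
have N1E' : N2 *m diag_mx nu = N1 by rewrite diag_mxC.
have N1N : N1 *m diag_mx nu = 1%:M.
  rewrite mulmx_diag -diag_const_mx; congr diag_mx; apply/rowP => i.
  by rewrite !mxE mulVf.
have l : (V *m V^T) *m (V *m N2 *m V^T) = V *m N1 *m V^T.
  by rewrite -!mulmxA [V^T *m (V *m _)]mulmxA VV [diag_mx nu *m _]mulmxA N1E.
have r : (V *m N2 *m V^T) *m (V *m V^T) = V *m N1 *m V^T.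
  by rewrite -!mulmxA [V^T *m (V *m _)]mulmxA VV [N2 *m (_ *m _)]mulmxA N1E'.
have sym : (V *m N1 *m V^T)^T = V *m N1 *m V^T.
  by rewrite !trmx_mul trmxK tr_diag_mx mulmxA.
split; rewrite ?l ?r// -!mulmxA [V^T *m (V *m _)]mulmxA VV [N1 *m (_ *m _)]mulmxA N1N mul1mx//.
Qed.

End MoorePenrose.

(** * The Lagrangian and the spectral decomposition *)

Section ConstrainedLeastSquares.
Variable R : realType.

Definition dot n (u v : 'cV[R]_n) : R := (u^T *m v) 0 0.

Lemma dotC n (u v : 'cV[R]_n) : dot u v = dot v u.
Proof. by rewrite /dot -[u^T *m v]trmxK trmx_mul trmxK mxE. Qed.

Lemma dotDr n (u v v' : 'cV[R]_n) : dot u (v + v') = dot u v + dot u v'.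
Proof. by rewrite /dot mulmxDr mxE. Qed.

Lemma dotDl n (u v v' : 'cV[R]_n) : dot (v + v') u = dot v u + dot v' u.
Proof. by rewrite dotC dotDr !(dotC u). Qed.

Lemma dotZr n a (u v : 'cV[R]_n) : dot u (a *: v) = a * dot u v.
Proof. by rewrite /dot -scalemxAr mxE. Qed.

Lemma dotZl n a (u v : 'cV[R]_n) : dot (a *: u) v = a * dot u v.
Proof. by rewrite dotC dotZr dotC. Qed.

Lemma dotMl m n (P : 'M[R]_(m, n)) u v : dot (P *m u) v = dot u (P^T *m v).
Proof. by rewrite /dot trmx_mul mulmxA. Qed.

Lemma dotE n (u : 'cV[R]_n) : dot u u = \sum_i u i 0 ^+ 2.
Proof. by rewrite /dot mxE; apply: eq_bigr => i _; rewrite mxE expr2. Qed.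

(* The point (x0, s0) is stationary for the Lagrangian with multiplier l, whose
   second-order expansion around it is exact; both points satisfy the
   constraint, where the Lagrangian and the objective agree. *)
Lemma lagrangian_expansion n k (P : 'M[R]_(n, k)) (c : 'cV[R]_n)
    (x x0 : 'cV[R]_k) (s s0 l : R) :
  let e : 'cV[R]_n := const_mx 1 in
  P^T *m e = 0 ->
  (P^T *m P - l%:M) *m x0 = P^T *m c ->
  n%:R * s0 = dot e c - 2 * l ->
  dot x0 x0 = 4 * s0 -> dot x x = 4 * s ->
  dot (P *m x + s *: e - c) (P *m x + s *: e - c) =
  dot (P *m x0 + s0 *: e - c) (P *m x0 + s0 *: e - c)
  + dot (x - x0) ((P^T *m P - l%:M) *m (x - x0)) + n%:R * (s - s0) ^+ 2.
Proof.
move=> e Pe x0E s0E feas0 feas.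
pose r := P *m x0 + s0 *: e - c; pose h := x - x0; pose t := s - s0.
have ee : dot e e = n%:R.
  rewrite dotE (eq_bigr (fun=> 1)) ?sumr_const ?card_ord// => i _.
  by rewrite mxE expr1n.
have eP (v : 'cV_k) : dot e (P *m v) = 0.
  by rewrite dotC dotMl Pe /dot mulmx0 mxE.
(* [Pr] and [er] say that the gradient of the Lagrangian vanishes at (x0, s0), in [x] and in [s]
   respectively. *)
have Pr : P^T *m r = l *: x0.
  rewrite /r mulmxBr mulmxDr -scalemxAr Pe scaler0 addr0 -x0E mulmxBl mulmxA.
  by rewrite subKr mul_scalar_mx.
have er : dot e r = - 2 * l.
  rewrite /r dotDr dotDr eP dotZr ee -scaleN1r dotZr; lra.
have -> : P *m x + s *: e - c = r + (P *m h + t *: e).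
  rewrite /r /h /t mulmxBr; move: (P *m x) (P *m x0) => u v.
  by apply/matrixP => i j; rewrite !mxE; ring.
have xE : x = h + x0 by rewrite subrK.
rewrite -/r -/h -/t; move: r Pr er h xE => r Pr er h xE.
rewrite !dotDr !dotDl !(dotZl, dotZr) !(dotMl _ _ e) Pe.
have -> : dot r (P *m h) = l * dot h x0 by rewrite dotC dotMl Pr dotZr.
rewrite (dotMl _ _ r) Pr dotZr.
have -> : dot r e = - 2 * l by rewrite dotC er.
rewrite eP er ee (dotMl _ _ (P *m h)) mulmxBl dotDr mul_scalar_mx.
rewrite -scaleN1r scalerA dotZr !mulmxA.
(* The difference of the two constraints turns the cross terms 2 l <h, x0> - 4 l t into -l |h|^2,
   the shift in [P^T *m P - l%:M]. *)
have h2 : 2 * dot h x0 + dot h h = 4 * t.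
  move: feas feas0; rewrite xE !dotDl !dotDr (dotC x0 h) /t.
  by lra.
have -> : dot h 0 = 0 by rewrite /dot mulmx0 mxE.
have -> : dot h h = 4 * t - 2 * dot h x0 by lra.
by rewrite expr2; ring.
Qed.

Lemma spectral_shift k (S : 'M[R]_k) (nu : 'rV[R]_k) (l : R) :
  S^T *m S = 1%:M ->
  S *m diag_mx nu *m S^T - l%:M = S *m diag_mx (nu - const_mx l) *m S^T.
Proof.
move=> /mulmx1C SS; rewrite raddfB/= diag_const_mx mulmxBr mulmxBl.
by rewrite mul_mx_scalar -scalemxAl SS scalemx1.
Qed.

Lemma spectral_unit k (S : 'M[R]_k) (nu : 'rV[R]_k) :
  S^T *m S = 1%:M -> (forall i, nu 0 i != 0) ->
  S *m diag_mx nu *m S^T \in unitmx.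
Proof.
move=> SS nu0; have [uSt uS] := mulmx1_unit SS.
rewrite !unitmx_mul uS uSt unitmxE det_diag unitfE andbT/=.
by apply/prodf_neq0 => i _.
Qed.

Lemma dot_spectral k (S : 'M[R]_k) (nu : 'rV[R]_k) (h : 'cV[R]_k) :
  dot h (S *m diag_mx nu *m S^T *m h) =
  \sum_i nu 0 i * (S^T *m h) i 0 ^+ 2.
Proof.
rewrite -!mulmxA -[S]trmxK -dotMl trmxK mul_diag_mx /dot mxE.
apply: eq_bigr => i _; rewrite [X in X * _]mxE [X in _ * X]mxE expr2.
by rewrite mulrCA.
Qed.

Lemma dot_spectral_ge0 k (S : 'M[R]_k) (nu : 'rV[R]_k) (h : 'cV[R]_k) :
  (forall i, 0 < nu 0 i) -> 0 <= dot h (S *m diag_mx nu *m S^T *m h).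
Proof.
move=> nu0; rewrite dot_spectral sumr_ge0// => i _.
by rewrite mulr_ge0 ?sqr_ge0// ltW.
Qed.

Lemma dot_spectral_eq0 k (S : 'M[R]_k) (nu : 'rV[R]_k) (h : 'cV[R]_k) :
  S^T *m S = 1%:M -> (forall i, 0 < nu 0 i) ->
  dot h (S *m diag_mx nu *m S^T *m h) = 0 -> h = 0.
Proof.
move=> /mulmx1C SS nu0; rewrite dot_spectral => /eqP.
rewrite psumr_eq0 => [/allP h0|i _]; last by rewrite mulr_ge0 ?sqr_ge0// ltW.
rewrite -[h]mul1mx -SS -mulmxA; suff -> : S^T *m h = 0 by rewrite mulmx0.
apply/colP => i; rewrite [RHS]mxE; apply/eqP.
have := h0 i (mem_index_enum _).
by rewrite /= mulf_eq0 (gt_eqF (nu0 i)) sqrf_eq0.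
Qed.

(** The system decouples in the orthonormal coordinates given by [S^T]. Once [nu] is shifted by the
    multiplier, the sum is the one in [f]. *)
Lemma dot_spectral_solution k (S : 'M[R]_k) (nu : 'rV[R]_k) (x g : 'cV[R]_k) :
  S^T *m S = 1%:M -> (forall i, nu 0 i != 0) ->
  S *m diag_mx nu *m S^T *m x = g ->
  dot x x = \sum_i (S^T *m g) i 0 ^+ 2 / nu 0 i ^+ 2.
Proof.
move=> SS nu0 <-; have SSt := mulmx1C SS.
rewrite !mulmxA SS mul1mx -mulmxA mul_diag_mx.
have -> : dot x x = dot (S^T *m x) (S^T *m x).
  by rewrite dotMl trmxK mulmxA SSt mul1mx.
rewrite dotE; apply: eq_bigr => i _; rewrite [in RHS]mxE exprMn.
by rewrite mulrAC divff ?mul1r// sqrf_eq0.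
Qed.

End ConstrainedLeastSquares.

(** At a feasible (x, s) the objective exceeds its value at (x0, s0) by a definite form in x - x0
    plus n (s - s0)^2; a tie forces both to vanish. *)
Lemma unique_optimal (R : realType) n (o : 'I_n) (P : 'M[R]_(n, 3)) D
    (dm : 'cV[R]_n) (x0 : 'cV[R]_3) (s0 l : R) :
  let e : 'cV[R]_n := const_mx 1 in
  let b : 'cV[R]_n := \col_i (P *m P^T) i i in
  let M := P^T *m P - l%:M in
  generating_points P D -> affine_dim P = 3%N ->
  P^T *m e = 0 ->
  (forall h, 0 <= dot h (M *m h)) ->
  (forall h, dot h (M *m h) = 0 -> h = 0) ->
  M *m x0 = P^T *m (dm - b) ->
  n%:R * s0 = dot e (dm - b) - 2 * l ->
  dot x0 x0 = 4 * s0 ->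
  unique (optimal D dm) (P *m x0 + s0 *: e + b).
Proof.
move=> e b M genP dimP Pe M_ge0 M_eq0 x0E s0E feas0.
have scP := self_consistent_param o _ genP dimP.
have objE x s : dot x x = 4 * s -> enorm (P *m x + s *: e + b - dm) ^+ 2 =
    enorm (P *m x0 + s0 *: e + b - dm) ^+ 2
    + (dot (x - x0) (M *m (x - x0)) + n%:R * (s - s0) ^+ 2).
  move=> feas; rewrite !enorm_sqr_col.
  by have := lagrangian_expansion Pe x0E s0E feas0 feas; rewrite opprB !addrA.
have nt_ge0 (t : R) : 0 <= n%:R * t ^+ 2 by rewrite mulr_ge0 ?sqr_ge0 ?ler0n.
have sc0 : self_consistent D (P *m x0 + s0 *: e + b).
  by apply/scP; exists x0, s0.
split=> [|y [/scP[x [s [feas ->]]] /(_ _ sc0)]].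
  split=> // _ /scP[x [s [feas ->]]].
  by rewrite (objE _ _ feas) lerDl addr_ge0.
rewrite (objE _ _ feas) gerDl => le0.
have := M_ge0 (x - x0); have := nt_ge0 (s - s0) => t_ge0 h_ge0.
have /M_eq0 /subr0_eq -> : dot (x - x0) (M *m (x - x0)) = 0 by lra.
have : n%:R * (s - s0) ^+ 2 = 0 by lra.
have n_neq0 : n%:R != 0 :> R by rewrite pnatr_eq0 -lt0n (leq_trans _ (ltn_ord o)).
by move/eqP; rewrite mulf_eq0 (negbTE n_neq0) sqrf_eq0 => /eqP/subr0_eq ->.
Qed.

(** * Locating the root and recovering the optimal solution *)

Theorem mainTheorem5 (R : realType) (n : nat) (D : 'M[R]_n)
    (P : 'M[R]_(n, 3)) (Bd : 'M[R]_n) (S : 'M[R]_3) (nu : 'rV[R]_3)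
    (dm : 'cV[R]_n) :
  let e : 'cV[R]_n := const_mx 1 in
  let B : 'M[R]_n := P *m P^T in
  let b : 'cV[R]_n := \col_i B i i in
  let c : 'cV[R]_n := dm - b in
  let ec : R := (e^T *m c) 0 0 in
  let kappa : R := 4 / n%:R * ec - (c^T *m Bd *m c) 0 0 in
  let w : 'cV[R]_3 := S^T *m P^T *m c in
  let nu3 : R := nu 0 ord_max in
  let f (l : R) : R :=
    \sum_(i < 3) w i 0 ^+ 2 / (nu 0 i - l) ^+ 2
      + 8 / n%:R * l - 4 / n%:R * ec in
  let is_root (l : R) : Prop := l < nu3 /\ f l = 0 in
  let xs (l : R) : 'cV[R]_3 := invmx (P^T *m P - l%:M) *m P^T *m c in
  let ss (l : R) : R := n%:R^-1 * (ec - 2 * l) in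
  (5 <= n)%N ->
  EDM_of_dim D 3 ->
  generating_points P D ->
  affine_dim P = 3%N ->
  \sum_i row i P = 0 ->
  moore_penrose B Bd ->
  S^T *m S = 1%:M ->
  P^T *m P = S *m diag_mx nu *m S^T ->
  (forall i j : 'I_3, (i <= j)%N -> nu 0 j <= nu 0 i) ->
  0 < nu3 ->
  w ord_max 0 != 0 ->
  [/\ forall l1 l2 : R, l1 < l2 -> l2 < nu3 -> f l1 < f l2,
      f 0 = - kappa,
      kappa = 0 ->
        unique is_root 0 /\
        ((exists (x : 'cV[R]_3) (s : R), c = P *m x + s *: e) ->
         unique (optimal D dm) dm /\ self_consistent D dm),
      0 < kappa -> exists! l : R, (0 < l < nu3) /\ f l = 0
    & kappa < 0 ->
        f (n%:R / 8 * kappa) < 0 /\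
        exists! l : R, (n%:R / 8 * kappa < l < 0) /\ f l = 0] /\
  exists ls,
    [/\ unique is_root ls,
        P^T *m P - ls%:M \in unitmx
      & unique (optimal D dm) (P *m xs ls + ss ls *: e + b)].
Proof.
move=> e B b c ec kappa w nu3 f is_root xs ss n5 _ genP dimP sumP mpB SS specP.
move=> nu_noninc nu3_gt0 w3.
have n_gt0 : (0 < n)%N by apply: leq_trans n5.
have nR_gt0 : 0 < n%:R :> R by rewrite ltr0n.
have n8_gt0 : 0 < 8 / n%:R :> R by rewrite divr_gt0.
have nu_ge i : nu3 <= nu 0 i by apply: nu_noninc; rewrite -ltnS.
have nu_gt0 i : 0 < nu 0 i by apply: lt_le_trans (nu_ge i).
have nu_neq0 i : nu 0 i != 0 by rewrite gt_eqF.
have f_lt l1 l2 : l1 < l2 -> l2 < nu3 -> f l1 < f l2 by apply: secular_lt.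
have f_inj l1 l2 : l1 < nu3 -> l2 < nu3 -> f l1 = 0 -> f l2 = 0 -> l1 = l2.
  exact: secular_root_inj.
have f_ivt l1 l2 : l1 <= l2 -> l2 < nu3 -> f l1 < 0 -> 0 < f l2 ->
    exists l, l1 < l < l2 /\ f l = 0 by exact: secular_ivt.
have Pe : P^T *m e = 0.
  apply/colP => j; move/rowP/(_ j): sumP; rewrite summxE !mxE.
  by apply: etrans; apply: eq_bigr => i _; rewrite !mxE mulr1.
(* The columns of V = P S are orthogonal with squared lengths nu_i, and V V^T = B, so the explicit
   pseudoinverse yields the sum in [f] at 0. *)
have cBdc : (c^T *m Bd *m c) 0 0 = \sum_(i < 3) w i 0 ^+ 2 / nu 0 i ^+ 2.
  have [V [VV VB wV]] : exists V : 'M_(n, 3),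
      [/\ V^T *m V = diag_mx nu, V *m V^T = B & w = V^T *m c].
    exists (P *m S); rewrite trmx_mul; split=> //.
    - by rewrite -mulmxA [P^T *m _]mulmxA specP -!mulmxA SS mulmx1 mulmxA SS mul1mx.
    - by rewrite -mulmxA [S *m (_ *m _)]mulmxA (mulmx1C SS) mul1mx.
  have := moore_penrose_gram VV nu_neq0; rewrite VB => /(moore_penrose_uniq mpB) ->.
  have wtV : w^T = c^T *m V by rewrite wV trmx_mul trmxK.
  rewrite !mulmxA -wtV -mulmxA -wV -mulmxA mul_diag_mx mxE.
  apply: eq_bigr => i _; rewrite [X in X * _]mxE [X in _ * X]mxE.
  by rewrite [X in _ * (X * _)]mxE mulrCA -expr2 mulrC.
have f0 : f 0 = - kappa.
  rewrite /f /kappa cBdc mulr0 addr0 opprB; congr (_ - _).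
  by apply: eq_bigr => i _; rewrite subr0.
(* Here [f 0 = - kappa] is negative, while [f] becomes positive near the pole [nu3] because w_3 is
   nonzero. *)
have pos_case : 0 < kappa -> exists l, (0 < l < nu3) /\ f l = 0.
  move=> k0; have [l2 [/andP[l2_gt0 l2nu] f2]] :
      exists l, 0 < l < nu3 /\ 0 < f l.
    exact: (@secular_gt0 _ _ (fun i => w i 0) (nu 0) _ _ _ n8_gt0 0 ord_max).
  have [|l [/andP[l0 ll2] fl]] := f_ivt 0 l2 (ltW l2_gt0) l2nu _ f2.
    by rewrite f0 oppr_lt0.
  by exists l; rewrite l0 (lt_trans ll2).
have neg_case : kappa < 0 -> f (n%:R / 8 * kappa) < 0 /\
    exists l, (n%:R / 8 * kappa < l < 0) /\ f l = 0.
  move=> k0; set l0 := n%:R / 8 * kappa.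
  have l0_lt0 : l0 < 0 by rewrite pmulr_rlt0// divr_gt0.
  (* The choice of [l0] makes the linear term equal to [kappa], so [f l0] is the sum at [l0] minus
     the sum at 0. Each term is nondecreasing, and the one of [nu3] is strictly increasing since w_3
     is nonzero. *)
  have fl0 : f l0 < 0.
    have nl0 : 8 / n%:R * l0 = kappa.
      by rewrite /l0; field; rewrite gt_eqF.
    rewrite /f nl0 /kappa cBdc addrA addrAC addrK subr_lt0.
    have nu3_lt : nu3 < nu3 - l0 by rewrite ltrDl oppr_gt0.
    have nu3l0_gt0 : 0 < nu3 - l0 by apply: lt_trans nu3_lt.
    rewrite (bigD1 ord_max)//= [ltRHS](bigD1 ord_max)//= ltr_leD//.
      rewrite ltr_pM2l ?exprn_even_gt0// ltf_pV2 ?posrE ?exprn_gt0//.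
      by rewrite ltr_pXn2r// nnegrE ltW.
    apply: ler_sum => i _; have := @secular_sum_le _ _ (fun i => w i 0) _ _ nu_ge l0 0 i.
    by rewrite subr0; apply; rewrite ?ltW.
  split=> //; apply: f_ivt => //; first exact: ltW.
  by rewrite f0 oppr_gt0.
have ex_root : exists l, is_root l.
  case: (ltgtP kappa 0) => [/neg_case[_ [l [/andP[_ l0] fl]]]|/pos_case[l [/andP[_ l0] fl]]|k0].
  - by exists l; split=> //; apply: lt_trans nu3_gt0.
  - by exists l.
  - by exists 0; split=> //; rewrite f0 k0 oppr0.
have root_uniq l : is_root l -> unique is_root l.
  by move=> [lnu fl]; split=> // l' [l'nu fl']; apply: f_inj.
have root_opt l : is_root l -> P^T *m P - l%:M \in unitmx /\
    unique (optimal D dm) (P *m xs l + ss l *: e + b).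
  (* Below [nu3] all shifted eigenvalues are positive, so P^T P - l I is positive definite. *)
  move=> [lnu fl]; rewrite /xs specP spectral_shift//.
  set nul := nu - const_mx l.
  have nulE i : nul 0 i = nu 0 i - l by rewrite !mxE.
  have nul_gt0 i : 0 < nul 0 i by rewrite nulE subr_gt0 (lt_le_trans lnu).
  have nul_neq0 i : nul 0 i != 0 by rewrite gt_eqF.
  have unitM := spectral_unit SS nul_neq0.
  have solM := mulKVmx unitM (P^T *m c); rewrite [invmx _ *m (_ *m c)]mulmxA in solM.
  split=> //; apply: (@unique_optimal _ _ (Ordinal n_gt0) _ _ _ _ _ l) => //.
  - by move=> h; rewrite specP spectral_shift//; apply: dot_spectral_ge0.
  - by move=> h; rewrite specP spectral_shift//; apply: dot_spectral_eq0.
  - by rewrite specP spectral_shift.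
  - by rewrite /ss mulrA divff ?gt_eqF// mul1r.
  (* The constraint |x|^2 = 4 s is exactly [f l = 0], because 4 s = (4/n) e^T c - (8/n) l. *)
  - rewrite (dot_spectral_solution SS nul_neq0 solM).
    move: fl; rewrite /f /ss mulmxA -/w.
    rewrite (eq_bigr (fun i => w i 0 ^+ 2 / nul 0 i ^+ 2)); last by move=> i _; rewrite nulE.
    move/eqP; rewrite addrAC -addrA addr_eq0 => /eqP ->.
    by field; rewrite gt_eqF.
split; last first.
  by have [l rl] := ex_root; exists l; have [? ?] := root_opt l rl; split=> //; apply: root_uniq.
split=> //.
- move=> k0; have r0 : is_root 0 by split=> //; rewrite f0 k0 oppr0.
  split; first exact: root_uniq.
  (* [kappa] involves [c] only through P^T c and e^T c, so its vanishing says nothing about a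
     component of [c] orthogonal to [e] and the columns of [P]; [cE] excludes such a component.
     Since P^T e = 0, the formulas at multiplier 0 then return [x] and [s] themselves. *)
  move=> [x [s cE]]; have [u0 opt0] := root_opt 0 r0.
  suff ysE : P *m xs 0 + ss 0 *: e + b = dm.
    by rewrite ysE in opt0; split=> //; case: opt0 => [[]].
  have ee : e^T *m e = n%:R%:M.
    apply/matrixP => i j; rewrite !ord1 !mxE (eq_bigr (fun=> 1)) ?sumr_const ?card_ord//.
    by move=> l _; rewrite !mxE mulr1.
  have eP : e^T *m P = 0 by rewrite -[LHS]trmxK trmx_mul trmxK Pe trmx0.
  have -> : xs 0 = x.
    rewrite /xs -mulmxA cE mulmxDr -scalemxAr Pe scaler0 addr0 [P^T *m (_ *m _)]mulmxA.
    by rewrite raddf0 subr0 in u0 *; rewrite mulKmx.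
  have -> : ss 0 = s.
    rewrite /ss /ec cE mulmxDr mulmxA eP mul0mx add0r -scalemxAr ee !mxE mulr1n.
    by field; rewrite gt_eqF.
  by rewrite -cE /c subrK.
- move=> k0; have [l [/andP[l0 lnu] fl]] := pos_case k0.
  exists l; split; first by rewrite l0 lnu.
  by move=> l' [/andP[_ l'nu] fl']; apply: f_inj.
- move=> k0; have [fl0 [l [/andP[ll0 l0] fl]]] := neg_case k0.
  split=> //; exists l; split; first by rewrite ll0 l0.
  by move=> l' [/andP[_ l'0] fl']; apply: f_inj => //; apply: lt_trans nu3_gt0.
Qed.
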